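(* Let $V$ be the evaluation function of a weighted separable attribute model with utility function $u$ and weight function $w$, and let $u^{0}(t)=u(t)w(t,0)$ for $t\in\mathbb{R}$. The following two statements are equivalent. (a) Both of the following hold: (Injective) for all real $t>s>0$, $u^{0}(t)\neq u^{0}(s)$; and (Linearity) for all real $t>s>0$, $u^{0}(t-s)=u(t)w(t,s)-u(s)w(s,t)$. (b) For all real $x_{1},x_{2},y_{2}>0$ with $y_{2}>x_{2}$, with the two-attribute alternatives $x=(x_{1},x_{2})$ and $y=(0,y_{2})$, one has $V(x|\{x,y\})=V(y|\{y,x\})$ if and only if $x_{1}+x_{2}=y_{2}$. The result also holds when the alternatives have additional attributes with constants: for every $N\geq 3$ and all $c_{3},\dots,c_{N}\in\mathbb{R}$, (a) is equivalent to the statement obtained from (b) by replacing $x$ and $y$ with $x=(x_{1},x_{2},c_{3},\dots,c_{N})$ and $y=(0,y_{2},c_{3},\dots,c_{N})$.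
   Context: An alternative is a vector $x=(x_{1},\dots,x_{N})\in\mathbb{R}^{N}$ of attribute values. A utility function is a weakly increasing function $u:\mathbb{R}\to\mathbb{R}$ with $u(0)=0$ (and $|u(t)|<\infty$ for all $t\in\mathbb{R}$). A weight function is any function $w:\mathbb{R}\times\mathbb{R}\to\mathbb{R}_{+}=[0,\infty)$ (with $w(t,s)<\infty$ for all $t,s\in\mathbb{R}$). A weighted separable attribute model, given by $u$ and $w$ (the same $u$ and $w$ for all attributes), evaluates an alternative $x$ in a binary menu $\{x,y\}$, where $x,y\in\mathbb{R}^{N}$ satisfy $x_{n}y_{n}\geq 0$ for all $n$, by $$V(x|\{x,y\})=\sum_{n=1}^{N}u(x_{n})\,w(x_{n},y_{n}).$$ In $V(x|\{x,y\})$, $x$ is the evaluated alternative and $y$ the comparison alternative, so $V(y|\{y,x\})=\sum_{n=1}^{N}u(y_{n})\,w(y_{n},x_{n})$. *)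

(* Defs.v *)
From mathcomp Require Import all_boot all_order all_algebra.
From mathcomp Require Import reals.

Set Implicit Arguments.
Unset Strict Implicit.
Unset Printing Implicit Defensive.

Import Order.TTheory GRing.Theory Num.Theory.
Local Open Scope ring_scope.

Definition utility (R : realType) (u : R -> R) : Prop :=
  {homo u : s t / s <= t} /\ u 0 = 0.

Definition weight (R : realType) (w : R -> R -> R) : Prop :=
  forall t s, 0 <= w t s.

Definition binary_menu (R : realType) (N : nat) (x y : 'rV[R]_N) : Prop :=
  forall n, 0 <= x ord0 n * y ord0 n.

(* V(x|{x,y}): the first alternative is evaluated, the second is the one it is
   compared with. The formula is written for all pairs, but it is the value of
   the model only when [binary_menu x y] holds. *)
Definition evaluation (R : realType) (u : R -> R) (w : R -> R -> R)
    (N : nat) (x y : 'rV[R]_N) : R :=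
  \sum_(n < N) u (x ord0 n) * w (x ord0 n) (y ord0 n).

Definition base_value (R : realType) (u : R -> R) (w : R -> R -> R) (t : R) : R :=
  u t * w t 0.

Definition alt2 (R : realType) (a b : R) : 'rV[R]_2 :=
  \row_(n < 2) [:: a; b]`_n.

(* (a, b, c_3, ..., c_N) with N = 2 + m *)
Definition alt_const (R : realType) (m : nat) (a b : R) (c : 'rV[R]_m) :
    'rV[R]_(2 + m) :=
  row_mx (alt2 a b) c.

(* Pairs of the form used to test additivity always form an admissible menu. *)
Lemma binary_menu_alt2 (R : realType) (x1 x2 y2 : R) :
  0 < x2 -> 0 < y2 -> binary_menu (alt2 x1 x2) (alt2 0 y2).
Proof.
move=> x20 y20 n; rewrite !mxE.
by case: n => -[|[|//]] ? /=; rewrite ?mulr0 ?mulr_ge0 // ltW.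
Qed.

Lemma binary_menu_alt_const (R : realType) (m : nat) (x1 x2 y2 : R)
    (c : 'rV[R]_m) :
  0 < x2 -> 0 < y2 -> binary_menu (alt_const x1 x2 c) (alt_const 0 y2 c).
Proof.
move=> x20 y20 n; rewrite /alt_const; case: (splitP n) => j nj.
  have -> : n = lshift m j by apply: val_inj.
  by rewrite !row_mxEl; apply: binary_menu_alt2.
have -> : n = rshift 2 j by apply: val_inj.
by rewrite !row_mxEr -expr2 sqr_ge0.
Qed.

Definition injectivity (R : realType) (u : R -> R) (w : R -> R -> R) : Prop :=
  forall t s : R, 0 < s -> s < t -> base_value u w t <> base_value u w s.

Definition linearity (R : realType) (u : R -> R) (w : R -> R -> R) : Prop :=
  forall t s : R, 0 < s -> s < t ->
    base_value u w (t - s) = u t * w t s - u s * w s t.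

(* Main.v *)
(* Write [u0] for [base_value u w]. Since [u 0 = 0] and common attributes cancel,
   indifference between x and y reads
   [u0 x1 = u y2 * w y2 x2 - u x2 * w x2 y2]. Linearity turns the right-hand side
   into [u0 (y2 - x2)], and injectivity of [u0] then forces [x1 = y2 - x2].
   Conversely, linearity is the case [x1 = t - s], and if [u0 t = u0 s] then both
   [x1 = t] and [x1 = s] solve the equation at [(x2, y2) = (1, t + 1)], so that
   [t = s]. *)
Require Import Defs.
From mathcomp Require Import all_boot all_order all_algebra.
From mathcomp Require Import reals.

Set Implicit Arguments.
Unset Strict Implicit.
Unset Printing Implicit Defensive.

Import Order.TTheory GRing.Theory Num.Theory.
Local Open Scope ring_scope.

Lemma evaluation_alt2 (R : realType) (u : R -> R) (w : R -> R -> R)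
    (a b a' b' : R) :
  evaluation u w (alt2 a b) (alt2 a' b') = u a * w a a' + u b * w b b'.
Proof. by rewrite /evaluation !big_ord_recl big_ord0 addr0 !mxE. Qed.

Lemma evaluation_row_mx (R : realType) (u : R -> R) (w : R -> R -> R)
    (m n : nat) (x y : 'rV[R]_m) (x' y' : 'rV[R]_n) :
  evaluation u w (row_mx x x') (row_mx y y') =
  evaluation u w x y + evaluation u w x' y'.
Proof.
rewrite /evaluation big_split_ord /=.
by congr (_ + _); apply: eq_bigr => i _; rewrite ?row_mxEl ?row_mxEr.
Qed.

(** The zero attribute of the second alternative contributes [u 0 * w 0 x1 = 0], so [x1] enters the
    equation only through its base value. *)
Lemma indifference_alt2 (R : realType) (u : R -> R) (w : R -> R -> R)
    (x1 x2 y2 : R) :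
  u 0 = 0 ->
  evaluation u w (alt2 x1 x2) (alt2 0 y2) =
    evaluation u w (alt2 0 y2) (alt2 x1 x2) <->
  base_value u w x1 = u y2 * w y2 x2 - u x2 * w x2 y2.
Proof.
move=> u0; rewrite !evaluation_alt2 u0 mul0r add0r /base_value.
by split=> [<-|->]; rewrite ?addrK ?subrK.
Qed.

(** Both sides contain the same summand [evaluation u w c c], which cancels. *)
Lemma indifference_alt_const (R : realType) (u : R -> R) (w : R -> R -> R)
    (m : nat) (a b a' b' : R) (c : 'rV[R]_m) :
  evaluation u w (alt_const a b c) (alt_const a' b' c) =
    evaluation u w (alt_const a' b' c) (alt_const a b c) <->
  evaluation u w (alt2 a b) (alt2 a' b') =
    evaluation u w (alt2 a' b') (alt2 a b).
Proof.
by rewrite /alt_const !evaluation_row_mx; split=> [/addIr|->].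
Qed.

(** Indifference with or without constant attributes reduces to this one equation, so both parts of
    the theorem follow from it. *)
Lemma injectivity_linearityP (R : realType) (u : R -> R) (w : R -> R -> R) :
  injectivity u w /\ linearity u w <->
  (forall x1 x2 y2 : R, 0 < x1 -> 0 < x2 -> 0 < y2 -> x2 < y2 ->
     base_value u w x1 = u y2 * w y2 x2 - u x2 * w x2 y2 <-> x1 + x2 = y2).
Proof.
split=> [[inj lin] x1 x2 y2 x1_gt0 x2_gt0 _ lt_xy|indiff].
  rewrite -(lin y2 x2 x2_gt0 lt_xy); split=> [eq_u|<-]; last by rewrite addrK.
  have d_gt0 : 0 < y2 - x2 by rewrite subr_gt0.
  suff -> : x1 = y2 - x2 by rewrite subrK.
  (* [injectivity] speaks of ordered positive pairs only, so each strict order is refuted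
     separately. *)
  case: (ltgtP x1 (y2 - x2)) => // lt_xd.
    by case: (inj _ _ x1_gt0 lt_xd).
  by case: (inj _ _ d_gt0 lt_xd).
have lin : linearity u w.
  move=> t s s_gt0 lt_st; apply/indiff; rewrite ?subr_gt0 ?subrK //.
  exact: lt_trans lt_st.
split=> // t s s_gt0 lt_st eq_u.
have t_gt0 : 0 < t by apply: lt_trans lt_st.
have lt1 : 1 < t + 1 by rewrite ltrDr.
have t1_gt0 : 0 < t + 1 by apply: lt_trans lt1.
(* Any positive [x2] would do in place of [1]; [y2 = t + 1] makes [x1 = t] a solution, and [eq_u]
   carries the equation over to [x1 = s]. *)
have /addIr eq_st : s + 1 = t + 1.
  apply/(indiff s 1 (t + 1) s_gt0 ltr01 t1_gt0 lt1); rewrite -eq_u.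
  exact/(indiff t 1 (t + 1) t_gt0 ltr01 t1_gt0 lt1).
by rewrite eq_st ltxx in lt_st.
Qed.

Theorem proposition3 (R : realType) (u : R -> R) (w : R -> R -> R)
    (hu : utility u) (hw : weight w) :
  ((injectivity u w /\ linearity u w) <->
   (forall x1 x2 y2 : R, 0 < x1 -> 0 < x2 -> 0 < y2 -> x2 < y2 ->
      let x := alt2 x1 x2 in
      let y := alt2 0 y2 in
      evaluation u w x y = evaluation u w y x <-> x1 + x2 = y2))
  /\
  (forall (m : nat) (c : 'rV[R]_m), (1 <= m)%N ->
    ((injectivity u w /\ linearity u w) <->
     (forall x1 x2 y2 : R, 0 < x1 -> 0 < x2 -> 0 < y2 -> x2 < y2 ->
        let x := alt_const x1 x2 c in
        let y := alt_const 0 y2 c in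
        evaluation u w x y = evaluation u w y x <-> x1 + x2 = y2))).
Proof.
have [_ u0] := hu.
split=> [|m c _]; rewrite injectivity_linearityP; split=> H x1 x2 y2 *.
- by rewrite /= indifference_alt2 //; apply: H.
- by rewrite -indifference_alt2 //; apply: H.
- by rewrite /= indifference_alt_const indifference_alt2 //; apply: H.
- by rewrite -indifference_alt2 // -(indifference_alt_const _ _ _ _ _ _ c); apply: H.
Qed.
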